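(* Let $\mathcal I$ be an analytic $P$-ideal on $\mathbb N_0$, let $K$ be a compact abelian group, and let $\mathbf u=(u_n)_{n\in\mathbb N_0}$ be a sequence in the discrete abelian group $K^\wedge$. Then $$s^{\mathcal I}_{\mathbf u}(K)=\{x\in K: u_n(x)\ \mathcal I\text{-converges to }0\text{ in }\mathbb T\}$$ is an $F_{\sigma\delta}$-set, in particular a Borel subset, of $K$.
   Context: $\mathbb N_0=\{0,1,2,\dots\}$, $\mathbb T=\mathbb R/\mathbb Z$. Topological groups called compact are assumed Hausdorff; $K^\wedge$ is the group of continuous homomorphisms $K\to\mathbb T$. An ideal $\mathcal I$ on $\mathbb N_0$ is a nonempty family of subsets of $\mathbb N_0$ closed under taking subsets and finite unions. A sequence $(x_n)$ in a topological space $\mathcal I$-converges to $x$ if $\{n\in\mathbb N_0: x_n\notin U\}\in\mathcal I$ for every neighborhood $U$ of $x$. $\mathcal I$ is a $P$-ideal if for every sequence $(I_n)$ of elements of $\mathcal I$ there exists $I\in\mathcal I$ such that $I_n\setminus I$ is finite for all $n$. $\mathcal I$ is analytic if, regarded as a subset of the compact metric space $\{0,1\}^{\mathbb N_0}$ (identified with $\mathcal P(\mathbb N_0)$, with the product topology), it is an analytic set, i.e., a continuous image of a Borel subset of a Polish space. An $F_{\sigma\delta}$-set is a countable intersection of countable unions of closed sets. *)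

(* Defs.v *)
From HB Require Import structures.
From mathcomp Require Import all_boot all_order all_algebra ring_quotient.
From mathcomp Require Import all_classical all_reals all_analysis borel_hierarchy.

Set Implicit Arguments.
Unset Strict Implicit.
Unset Printing Implicit Defensive.

Import Order.TTheory GRing.Theory Num.Theory.
Import numFieldNormedType.Exports.

Local Open Scope classical_set_scope.
Local Open Scope ring_scope.

(* The copy of Num.int as a plain predicate is needed to form the quotient
   group, since Quotient.quot expects a zmodClosed structure on a predicate. *)
Definition integers (R : realType) : {pred R} := Num.int.
HB.instance Definition _ (R : realType) :=
  GRing.ZmodClosed.copy (@integers R) (@Num.int_num_subdef R).

(* R/Z. A set is open when its preimage in R is; the library's
   quotient_topology alias is not used for the carrier because its eqType and
   choiceType instances differ from those of the quotient group. *)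
Definition circle (R : realType) : Type := Quotient.quot (@integers R).
HB.instance Definition _ (R : realType) := GRing.Zmodule.on (circle R).
HB.instance Definition _ (R : realType) := Quotient.on (circle R).

Section circle_topology.
Variable R : realType.
Let Q : topologicalType := quotient_topology (circle R).
HB.instance Definition _ := @isOpenTopological.Build (circle R)
  (@quotient_open _ (circle R)) (@openT Q) (@openI Q)
  (fun I f of_ => @bigcup_open Q I setT f (fun i _ => of_ i)).
End circle_topology.

Definition dual_group (R : realType) (K : topologicalZmodType) :
    set (K -> circle R) :=
  [set chi : K -> circle R | {morph chi : x y / x + y} /\ continuous chi].
Arguments dual_group : clear implicits.

(* Ideals may contain [set: nat]: properness is not required. *)
Definition is_ideal (I : set (set nat)) : Prop :=
  [/\ I !=set0,
      forall A B, B `<=` A -> I A -> I B &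
      forall A B, I A -> I B -> I (A `|` B)].

Definition P_ideal (I : set (set nat)) : Prop :=
  is_ideal I /\
  forall A : nat -> set nat, (forall n, I (A n)) ->
    exists2 B, I B & forall n, finite_set (A n `\` B).

Definition ideal_cvg (I : set (set nat)) (T : topologicalType)
    (x : nat -> T) (l : T) : Prop :=
  forall U, nbhs l U -> I [set n | ~ U (x n)].

Definition borel (T : topologicalType) (A : set T) : Prop :=
  <<s [set U : set T | open U] >> A.

(* A Polish space is presented with a choice of compatible complete metric. *)
Definition polish (R : realType) (P : metricType R) : Prop :=
  (forall x : nat -> P, cauchy (x @ \oo) -> exists l : P, x @ \oo --> l) /\
  exists2 D : set P, countable D & dense D.

Definition analytic (R : realType) (T : topologicalType) (A : set T) : Prop :=
  exists (P : metricType R) (B : set P) (f : P -> T),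
    [/\ polish P, borel B, {within B, continuous f} & A = f @` B].

(* A point x of cantor_space stands for the subset [set n | x n] of nat. *)
Definition analytic_ideal (R : realType) (I : set (set nat)) : Prop :=
  analytic R [set x : cantor_space | I [set n | x n]].

Definition Fsigmadelta (T : topologicalType) (S : set T) : Prop :=
  exists2 F : nat -> set T, (forall i, Fsigma (F i)) & S = \bigcap_i F i.

Definition ideal_characterized (R : realType) (I : set (set nat))
    (K : topologicalZmodType) (u : nat -> K -> circle R) : set K :=
  [set x | ideal_cvg I (fun n => u n x) 0].

(* Main.v *)
(* An analytic ideal I is the union of a tree of sets S s, s a finite sequence,
   such that points picked along a branch accumulate at an element of I. Since
   I is a P-ideal, a family W that is cofinal in I modulo finite sets cannot be
   split into countably many non-cofinal pieces. So below every node (s, F)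
   whose family {Y in S s : F subset of Y} is cofinal there is another such node, and
   each A in I has a tail A \ m that is captured: adding any finite subset of
   the tail to F keeps the family cofinal. Conversely a subset of the union of
   I with a captured tail at every cofinal node is covered, up to a finite set,
   by the limits of two branches, so it belongs to I. Being captured is tested
   on finite subsets, hence is a closed condition on x when A = {n : u_n x in O}
   with O open. It suffices to let O range over the complements of the closures
   of countably many arcs around 0. *)

Require Import Defs.
From HB Require Import structures.
From mathcomp Require Import all_boot all_order all_algebra ring_quotient.
From mathcomp Require Import all_classical all_reals all_analysis borel_hierarchy.
From mathcomp Require Import zify.

Set Implicit Arguments.
Unset Strict Implicit.
Unset Printing Implicit Defensive.

Import Order.TTheory GRing.Theory Num.Theory.
Import numFieldNormedType.Exports.

Local Open Scope classical_set_scope.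
Local Open Scope ring_scope.

(** * Cofinality modulo finite sets in a P-ideal *)

Definition cofinal_mod_fin (I W : set (set nat)) : Prop :=
  forall A, I A -> exists2 Y, W Y & finite_set (A `\` Y).

(** Otherwise each [V t] has a witness [A t] in [I] that none of its members almost contains. Some
    [B] in [I] almost contains every [A t], and some [Y] in [W] almost contains [B]; this [Y] lies
    in some [V t], a contradiction. *)
Lemma cofinal_bigcup (I W : set (set nat)) (T : countType)
    (V : T -> set (set nat)) :
  P_ideal I -> cofinal_mod_fin I W ->
  (forall Y, W Y -> exists t, V t Y) -> exists t, cofinal_mod_fin I (V t).
Proof.
move=> [[[A0 IA0] _ _] hP] cW WV; apply: contrapT => /forallNP nV.
have /choice[A AP] : forall t, exists A,
    I A /\ forall Y, V t Y -> ~ finite_set (A `\` Y).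
  move=> t; move: (nV t) => /existsNP[A /not_implyP[IA nA]].
  by exists A; split => // Y VY fY; apply: nA; exists Y.
have [|B IB BP] := hP (fun n => oapp A A0 (unpickle n)).
  by move=> n; case: unpickle => //= t; case: (AP t).
have [Y WY fY] := cW _ IB; have [t VY] := WV _ WY.
case: (AP t) => _ /(_ _ VY); apply.
apply: (@sub_finite_set _ _ ((A t `\` B) `|` (B `\` Y))).
  by move=> n [An nY]; have [Bn|nB] := pselect (B n); [right|left].
rewrite finite_setU; split => //.
by have := BP (pickle t); rewrite pickleK.
Qed.

(** * Regular schemes and captured sets *)

(* A continuous image of a closed set of branches, with continuity kept only in
   the one-sided form of [scheme_lim]. *)
Record regular_scheme (I : set (set nat)) (T : countType)
    (S : seq T -> set (set nat)) : Prop := RegularScheme {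
  scheme_nil : I `<=` S [::] ;
  scheme_rcons : forall s X, S s X -> exists t, S (rcons s t) X ;
  scheme_lim : forall (a : nat -> T) (X : nat -> set nat),
    (forall k, S (mkseq a k) (X k)) ->
    exists2 Y, I Y & forall n,
      (exists N, forall k, (N <= k)%N -> X k n) -> Y n }.

Definition node_set (T : Type) (S : seq T -> set (set nat))
    (v : seq T * seq nat) : set (set nat) :=
  [set X | S v.1 X /\ [set` v.2] `<=` X].

Definition big_node (I : set (set nat)) (T : Type)
    (S : seq T -> set (set nat)) (v : seq T * seq nat) : Prop :=
  cofinal_mod_fin I (node_set S v).

Definition captures (I : set (set nat)) (T : Type)
    (S : seq T -> set (set nat)) (v : seq T * seq nat) (m : nat)
    (A : set nat) : Prop :=
  forall G : seq nat, [set` G] `<=` [set n | (m <= n)%N /\ A n] ->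
    big_node I S (v.1, v.2 ++ G).

(** Otherwise each tail of [A] has a finite subset [G m] whose addition destroys cofinality. A
    member of the node that almost contains [A] contains [G N] for large [N]; the other members form
    the piece [None]. No piece is cofinal, against [cofinal_bigcup]. *)
Lemma captures_ideal (I : set (set nat)) (T : countType)
    (S : seq T -> set (set nat)) (v : seq T * seq nat) (A : set nat) :
  P_ideal I -> big_node I S v -> I A -> exists m, captures I S v m A.
Proof.
move=> hP bv IA; apply: contrapT => /forallNP nm.
have /choice[G GP] : forall m, exists G : seq nat,
    [set` G] `<=` [set n | (m <= n)%N /\ A n] /\
    ~ big_node I S (v.1, v.2 ++ G).
  by move=> m; move: (nm m) => /existsNP[G /not_implyP[GA nG]]; exists G.
pose V (t : option nat) : set (set nat) :=
  if t is Some m then node_set S (v.1, v.2 ++ G m)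
  else [set Y | ~ finite_set (A `\` Y)].
have [|[m|]] := cofinal_bigcup (V := V) hP bv; last 2 first.
- by move=> bm; case: (GP m).
- by move=> /(_ _ IA)[Y].
move=> Y [SY vY]; have [fY|] := pselect (finite_set (A `\` Y)); last first.
  by exists None.
have [N NP] : exists N, forall n, (A `\` Y) n -> (n < N)%N.
  have /finite_seqP[X XE] := fY.
  exists (\max_(i <- X) i).+1 => n; rewrite XE /= => nX.
  by rewrite ltnS; apply: leq_bigmax_seq.
exists (Some N); split => //= n /=; rewrite mem_cat => /orP[/vY//|nG].
have [/(_ _ nG)[/= Nn An] _] := GP N.
apply: contrapT => nY; have := NP n; rewrite ltnNge Nn.
by move=> /(_ (conj An nY)).
Qed.

(* The branches through nodes of even and of odd index are built in
   alternation: the even one covers [B] on the windows [p k, p k.+1[ with [k]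
   even, the odd one on the others. The end of each window is chosen large
   enough for the other branch to take over. *)
Lemma ideal_captures (I : set (set nat)) (T : countType)
    (S : seq T -> set (set nat)) (B : set nat) :
  P_ideal I -> regular_scheme I S ->
  (forall n, B n -> exists2 A, I A & A n) ->
  (forall v, big_node I S v -> exists m, captures I S v m B) -> I B.
Proof.
move=> hP hS BI hB; have [[[A0 IA0] Isub IU] _] := hP.
have big_ext v : big_node I S v -> exists t, big_node I S (rcons v.1 t, v.2).
  move=> bv; apply: (cofinal_bigcup hP bv) => Y [SY vY].
  by have [t St] := scheme_rcons hS SY; exists t.
have big_init : big_node I S ([::], [::]).
  move=> A IA; exists A; last by rewrite setDv.
  by split=> //; apply: scheme_nil hS _ IA.
have [t0 _] := big_ext _ big_init.
have /choice[m mP] : forall v, exists m, big_node I S v -> captures I S v m B.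
  by move=> v; have [/hB[m ?]|] := pselect (big_node I S v);
    [exists m|exists 0%N].
have /choice[nxt nxtP] : forall v, exists t,
    big_node I S v -> big_node I S (rcons v.1 t, v.2).
  by move=> v; have [/big_ext[t ?]|] := pselect (big_node I S v);
    [exists t|exists t0].
pose window p q := [seq n <- iota p (q - p) | `[< B n >]].
have windowE p q n :
    (n \in window p q) = [&& (p <= n)%N, (n < q)%N & `[< B n >]].
  rewrite mem_filter mem_iota andbC; case: `[< _ >]; rewrite ?andbT ?andbF //.
  by apply/idP/idP; lia.
pose ext (a : seq T * seq nat) G :=
  (rcons a.1 (nxt (a.1, a.2 ++ G)), a.2 ++ G).
(* A state holds two consecutive nodes and a cut. The new cut [q] is at least [m] of the second
   node, so the window starting at [q] can be added to that node at the next step. *)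
pose step (x : (seq T * seq nat) * (seq T * seq nat) * nat) :=
  let q := maxn x.2.+1 (m x.1.2) in (x.1.2, ext x.1.1 (window x.2 q), q).
pose st k := iter k step ([::], [::], ([::], [::]), m ([::], [::])).
pose a k := (st k).1.1.
pose p k := (st k).2.
have aS k : (st k).1.2 = a k.+1 by [].
have pS k : p k.+1 = maxn (p k).+1 (m (a k.+1)) by [].
have aSS k : a k.+2 = ext (a k) (window (p k) (p k.+1)) by [].
have mp k : (m (a k) <= p k)%N by case: k => // k; rewrite pS leq_maxr.
have pP k : (p k < p k.+1)%N by rewrite pS leq_maxl.
have abig k : big_node I S (a k).
  suff : big_node I S (a k) /\ big_node I S (a k.+1) by case.
  elim: k => [//|k [bk bk1]]; split=> //; rewrite aSS /ext.
  apply: (nxtP ((a k).1, (a k).2 ++ window (p k) (p k.+1))).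
  apply: (mP _ bk) => n /=; rewrite windowE => /and3P[pn _ /asboolP Bn].
  by split=> //; apply: leq_trans pn.
have cover e : a e = ([::], [::]) -> exists2 Y, I Y & forall k n, B n ->
    (p (k.*2 + e) <= n < p (k.*2 + e).+1)%N -> Y n.
  move=> ae; pose b k := a (k.*2 + e)%N.
  pose w k := window (p (k.*2 + e)%N) (p (k.*2 + e).+1).
  pose al k := nxt ((b k).1, (b k).2 ++ w k).
  have bS k : b k.+1 = (rcons (b k).1 (al k), (b k).2 ++ w k).
    by rewrite /b doubleS !addSn aSS.
  have bS1 k : (b k.+1).1 = rcons (b k).1 (al k) by rewrite bS.
  have bS2 k : (b k.+1).2 = (b k).2 ++ w k by rewrite bS.
  have bal k : (b k).1 = mkseq al k.
    elim: k => [|k IH]; first by rewrite /b add0n ae.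
    by rewrite bS1 IH mkseqS.
  have /choice[X XP] : forall k, exists X, node_set S (b k) X.
    by move=> k; have [X ? _] := abig (k.*2 + e)%N _ IA0; exists X.
  have [k|Y IY YP] := scheme_lim hS (a := al) (X := X).
    by rewrite -bal; case: (XP k).
  (* Points of the window [w k] enter the finite set of [b k.+1] and stay in all later ones, hence
     in [X l] for every [l > k]. *)
  exists Y => // k n Bn kn; apply: YP; exists k.+1 => l kl.
  case: (XP l) => _; apply => /=.
  have {kl} -> : l = (k.+1 + (l - k.+1))%N by lia.
  elim: (l - _)%N => [|j]; last first.
    by move=> IH; rewrite addnS (bS2 (k.+1 + j)%N) mem_cat IH.
  rewrite addn0 bS2 mem_cat windowE.
  by move: kn => /andP[-> ->]; rewrite (asboolT Bn) orbT.
have [Y0 IY0 Y0P] := cover 0%N erefl; have [Y1 IY1 Y1P] := cover 1%N erefl.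
(* The windows start at [p 0]. The points of [B] below it are collected one by one through [BI], as
   [I] may omit singletons. *)
have low N : I [set n | B n /\ (n < N)%N].
  elim: N => [|N IN]; first by apply: Isub IA0 => n [].
  have [BN|nBN] := pselect (B N); last first.
    apply: Isub IN => n [Bn]; rewrite ltnS leq_eqVlt => /orP[/eqP nN|//].
    by rewrite -nN in nBN.
  have [A IA AN] := BI _ BN; apply: Isub (IU _ _ IN IA) => n [Bn].
  by rewrite ltnS leq_eqVlt => /orP[/eqP->|]; [right|left].
apply: Isub (IU _ _ (low (p 0%N)) (IU _ _ IY0 IY1)) => n Bn.
have pge k : (k <= p k)%N by elim: k => // k IH; apply: leq_trans (pP k).
have find k : (n < p k)%N -> (n < p 0%N)%N \/
    exists j, (p j <= n < p j.+1)%N.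
  elim: k => [|k IH nk]; first by left.
  by have [/IH//|kn] := ltnP n (p k); right; exists k; rewrite kn.
have [||[j jn]] := find n.+1; first exact: pge; first by left.
right; rewrite -(odd_double_half j) addnC in jn.
case: (odd j) jn => jn; [right; apply: Y1P jn|left; apply: Y0P jn] => //.
Qed.

(** * Souslin sets and a scheme for an analytic ideal *)

(* [C] is sequentially closed in the product of [P] with the Baire space. *)
Definition seq_closed (P : topologicalType) (C : P -> (nat -> nat) -> Prop) :=
  forall (p : nat -> P) (a : nat -> nat -> nat) (q : P) (b : nat -> nat),
    p @ \oo --> q -> (forall j, \forall k \near \oo, a k j = b j) ->
    (\forall k \near \oo, C (p k) (a k)) -> C q b.

Definition souslin (P : topologicalType) (A : set P) : Prop :=
  exists2 C : P -> (nat -> nat) -> Prop, seq_closed C &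
    A = [set p | exists a, C p a].

Lemma souslin_closed (P : topologicalType) (A : set P) :
  closed A -> souslin A.
Proof.
move=> cA; exists (fun p _ => A p); last first.
  by apply/seteqP; split => [p|p []//]; exists (fun=> 0%N).
by move=> p a q b pq _ Ap; exact: (closed_cvg A cA Ap q pq).
Qed.

(** The coordinate [a 0] codes a radius. Along a convergent sequence it is eventually constant, and
    inclusion in [U] of balls of a fixed radius passes to the limit of the centers. *)
Lemma souslin_open (R : realType) (P : metricType R) (U : set P) :
  open U -> souslin U.
Proof.
move=> oU; exists (fun p a => ball p (harmonic (a 0%N) : R) `<=` U); last first.
  apply/seteqP; split=> [p Up|p [a]]; last first.
    by apply; apply: ballxx; exact: harmonic_gt0.
  have /nbhs_ballP[_/posnumP[e] eU] : nbhs p U by exact: open_nbhs_nbhs.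
  have [n _ /(_ n (leqnn n)) ne] := near_infty_natSinv_lt e.
  exists (fun=> n); apply: subset_trans eU; apply: le_ball; exact: ltW.
move=> p a q b pq ab Cp x; rewrite ballEmdist /= => qx.
have /cvg_ballP/(_ (harmonic (b 0%N) - mdist q x)) := pq.
rewrite subr_gt0 => /(_ qx) pqx.
have [k [+ [ak +]]] := @filter_ex _ _ _ _ (filterI pqx (filterI (ab 0%N) Cp)).
rewrite ballEmdist /= => qp; rewrite ak; apply; rewrite ballEmdist /=.
apply: le_lt_trans (metric_triangle _ q _) _.
by rewrite metric_sym -ltrBrDr.
Qed.

(** The coordinate [a 0] selects the index [n], and the shifted sequence is the witness for
    [A n]. *)
Lemma souslin_bigcup (P : topologicalType) (A : nat -> set P) :
  (forall n, souslin (A n)) -> souslin (\bigcup_n A n).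
Proof.
move=> sA.
have /choice[C CP] : forall n, exists C : P -> (nat -> nat) -> Prop,
    seq_closed C /\ A n = [set p | exists a, C p a].
  by move=> n; have [C] := sA n; exists C.
exists (fun p a => C (a 0%N) p (fun j => a j.+1)) => [p a q b pq ab Cp|].
  apply: (CP (b 0%N)).1 pq (fun j => ab j.+1) _.
  by apply: filterS2 (ab 0%N) Cp => k ->.
apply/seteqP; split=> [p [n _]|p [a Cp]]; last first.
  by exists (a 0%N) => //; rewrite (CP _).2; exists (fun j => a j.+1).
by rewrite (CP n).2 => -[a Cp]; exists (fun j => if j is i.+1 then a i else n).
Qed.

(** A pairing of indices packs witnesses for all [n] into one sequence. *)
Lemma souslin_bigcap (P : topologicalType) (A : nat -> set P) :
  (forall n, souslin (A n)) -> souslin (\bigcap_n A n).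
Proof.
move=> sA.
have /choice[C CP] : forall n, exists C : P -> (nat -> nat) -> Prop,
    seq_closed C /\ A n = [set p | exists a, C p a].
  by move=> n; have [C] := sA n; exists C.
exists (fun p a => forall n, C n p (fun j => a (pickle (n, j)))).
  move=> p a q b pq ab Cp n.
  apply: (CP n).1 pq (fun j => ab (pickle (n, j))) _.
  by apply: filterS Cp => k; apply.
apply/seteqP; split=> [p Ap|p [a Cp] n _]; last first.
  by rewrite (CP _).2; exists (fun j => a (pickle (n, j))).
have /choice[a aP] : forall n, exists a, C n p a.
  by move=> n; have := Ap n I; rewrite (CP n).2.
exists (fun m => if unpickle m is Some (n, j) then a n j else 0%N) => n.
by under eq_fun do rewrite pickleK.
Qed.

Lemma borel_souslin (R : realType) (P : metricType R) (B : set P) :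
  borel B -> souslin B.
Proof.
move=> bB; suff [] : souslin B /\ souslin (~` B) by [].
move: B bB; apply: (@smallest_sub _ _ _ [set B | souslin B /\ souslin (~` B)]).
  split=> [|A [sA sCA]|A sA] /=.
  - by rewrite setC0; split; apply: souslin_closed;
      [exact: closed0|exact: closedT].
  - by rewrite setTD setCK.
  - split; first by apply: souslin_bigcup => n; exact: (sA n).1.
    by rewrite setC_bigcup; apply: souslin_bigcap => n; exact: (sA n).2.
move=> U oU; split; first exact: souslin_open.
by apply: souslin_closed; apply: open_closedC.
Qed.

Lemma polish_centers (R : realType) (P : metricType R) (p0 : P) :
  polish P -> exists d : nat -> P,
    forall p (e : R), 0 < e -> exists i, ball (d i) e p.
Proof.
move=> [_ [D /countable_injP[g gi] dD]].
have /choice[d dP] : forall i, exists x,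
    (exists2 y, D y & g y = i) -> D x /\ g x = i.
  move=> i; have [[y Dy gy]|nex] := pselect (exists2 y, D y & g y = i).
    by exists y.
  by exists p0.
exists d => p e e0.
have nb : nbhs p (ball p e) by exact: nbhsx_ballx.
have [|y [/interior_subset py Dy]] := dD (interior (ball p e)) _ (open_interior _).
  by exists p.
exists (g y); have [|Dd gd] := dP (g y); first by exists y.
by rewrite (gi (d (g y)) y) ?inE //; exact: ball_sym.
Qed.

(** Entry [k] of a node prescribes a ball of radius [harmonic k] for the point [p] and the value
    [a k] of its Souslin witness. Along a branch the points are Cauchy, the witnesses converge, and
    closedness of [C] puts the limit in [B]. *)
Lemma analytic_scheme (R : realType) (I : set (set nat)) :
  I !=set0 -> analytic_ideal R I ->
  exists S : seq (nat * nat) -> set (set nat), regular_scheme I S.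
Proof.
move=> [A0 IA0] [P [B [f [pP bB fc IE]]]].
have If (X : set nat) : I X ->
    exists2 p, B p & f p = (fun n => `[< X n >]).
  move=> IX; have : [set x : cantor_space | I [set n | x n]] (fun n => `[< X n >]).
    rewrite /= (_ : [set n | _] = X) //.
    by apply/seteqP; split=> n /= /asboolP.
  by rewrite IE => -[p Bp fp]; exists p.
have [p0 _ _] := If _ IA0; have [d dP] := polish_centers p0 pP.
have [C Ccl BE] := borel_souslin bB.
exists (fun s => [set X | exists p a, [/\ C p a, f p = (fun n => `[< X n >]) &
  forall k, (k < size s)%N -> ball (d (nth (0%N, 0%N) s k).1) (harmonic k : R) p
    /\ a k = (nth (0%N, 0%N) s k).2]]).
split=> [X /If[p]|s X [p [a [Cpa fp sP]]]|al X XP].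
- by rewrite BE => -[a Cpa] fp; exists p, a; split.
- have [i di] := dP p (harmonic (size s)) (harmonic_gt0 _).
  exists (i, a (size s)), p, a; split=> // k.
  rewrite size_rcons ltnS leq_eqVlt nth_rcons => /orP[/eqP->|ks].
    by rewrite ltnn eqxx.
  by rewrite ks; exact: sP.
have /choice[pa paP] : forall k, exists pa : P * (nat -> nat),
    [/\ C pa.1 pa.2, f pa.1 = (fun n => `[< X k n >]) &
     forall j, (j < k)%N -> ball (d (al j).1) (harmonic j : R) pa.1 /\
       pa.2 j = (al j).2].
  move=> k; have [p [a [? ? H]]] := XP k; exists (p, a); split=> // j jk.
  by have := H j; rewrite size_mkseq nth_mkseq//; apply.
pose p k := (pa k).1.
have [q pq] : exists q : P, p @ \oo --> q.
  apply: pP.1; apply: cauchy_exP => _/posnumP[e].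
  have [n _ /(_ n (leqnn n)) ne] := near_infty_natSinv_lt e.
  exists (d (al n).1).
  suff : \forall k \near \oo, ball (d (al n).1) e%:num (p k) by [].
  near=> k; have [_ _ /(_ n)[|dk _]] := paP k.
    by near: k; exact: nbhs_infty_gt.
  by apply: le_ball dk; exact: ltW.
have Bq : B q.
  rewrite BE; exists (fun j => (al j).2).
  apply: (Ccl p (fun k => (pa k).2) _ _ pq) => [j|]; last first.
    by apply: nearW => k; have [] := paP k.
  near=> k; have [_ _ /(_ j)[|//]] := paP k.
  by near: k; exact: nbhs_infty_gt.
have fpq : f \o p @ \oo --> f q.
  have /subspace_continuousP/(_ q Bq) fq := fc.
  move=> U /fq fU.
  have pU : \forall k \near \oo, B (p k) -> U (f (p k)) by exact: pq _ fU.
  suff : \forall k \near \oo, U (f (p k)) by [].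
  apply: filterS pU => k; apply.
  by rewrite BE; exists (pa k).2; have [] := paP k.
exists [set n | f q n].
  suff : [set x : cantor_space | I [set n | x n]] (f q) by [].
  by rewrite IE; exists q.
(* Evaluation at [n] is continuous into the discrete [bool], so [f (p k) n] equals [f q n] for large
   [k]. *)
move=> n [N NP]; have nc : {for f q, continuous (fun x : cantor_space => x n)}.
  exact: (@proj_continuous _ (fun=> bool) n).
have := fpq _ (nc _ (discrete_set1 (f q n))) => fk.
near \oo => k => /=; suff <- : f (p k) n = f q n.
  by have [_ -> _] := paP k; apply/asboolP/NP; near: k; exact: nbhs_infty_ge.
by near: k.
Unshelve. all: by end_near.
Qed.

(** * Arcs in the circle *)

Notation circle_pi R := (\pi_(circle R)%qT : R -> circle R).

Lemma circle_pi_eqP (R : realType) (r t : R) :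
  reflect (circle_pi R r = circle_pi R t) (r - t \is a Num.int).
Proof.
have := Quotient.idealrBE (@integers R) r t.
rewrite /integers => ->. exact: eqP.
Qed.

Lemma circle_pi0 (R : realType) : circle_pi R 0 = 0.
Proof. by rewrite !piE. Qed.

Lemma circle_openE (R : realType) (U : set (circle R)) :
  open U = open (circle_pi R @^-1` U).
Proof. by []. Qed.

(** The preimage of the image is the union of the integer translates of [U]. *)
Lemma circle_pi_open (R : realType) (U : set R) :
  open U -> open (circle_pi R @` U).
Proof.
move=> oU; rewrite circle_openE.
rewrite (_ : _ @^-1` _ = \bigcup_(z in @integers R) ((fun r => r - z) @^-1` U)).
  apply: bigcup_open => z _; apply: open_comp oU => r _.
  by apply: cvgB; [exact: cvg_id|exact: cvg_cst].
apply/seteqP; split=> [r [t Ut /esym/circle_pi_eqP rt]|r [z zi Uz]].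
  by exists (r - t) => //=; rewrite subKr.
exists (r - z) => //; apply/circle_pi_eqP.
by rewrite addrAC subrr sub0r rpredN.
Qed.

Definition circle_arc (R : realType) (e : R) : set (circle R) :=
  circle_pi R @` ball 0 e.

Lemma circle_arc_nbhs (R : realType) (e : R) :
  0 < e -> nbhs (0 : circle R) (circle_arc e).
Proof.
move=> e0; apply: open_nbhs_nbhs; split.
  by apply: circle_pi_open; exact: ball_open.
by exists 0; [exact: ballxx|exact: circle_pi0].
Qed.

Lemma closure_circle_arc (R : realType) (e : R) :
  0 < e -> closure (circle_arc e) `<=` circle_arc (e + e).
Proof.
move=> e0 y; rewrite -[y]reprK; set t := repr y => cy.
have [|_ [[b b0e <-] [a ate /circle_pi_eqP ab]]] := cy (circle_pi R @` ball t e).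
  apply: open_nbhs_nbhs; split; first by apply: circle_pi_open; exact: ball_open.
  by exists t => //; exact: ballxx.
(* As [a - b] is an integer, this represents the same point as [t], and it is within [e] of [b]. *)
exists (t + b - a); last first.
  apply/circle_pi_eqP; rewrite (_ : _ - t = - (a - b)) ?rpredN //.
  by rewrite addrAC [t + b]addrC addrK opprB.
move: b0e ate; rewrite /ball /= !sub0r !normrN => be ta.
rewrite addrAC; apply: le_lt_trans (ler_normD _ _) _.
by rewrite ltrD.
Qed.

Lemma circle_nbhs0 (R : realType) (U : set (circle R)) :
  nbhs (0 : circle R) U -> exists j, closure (circle_arc (harmonic j)) `<=` U.
Proof.
rewrite nbhsE => -[V [oV V0] VU].
have /nbhs_ballP[_/posnumP[e] eV] : nbhs (0 : R) (circle_pi R @^-1` V).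
  by apply: open_nbhs_nbhs; split=> //=; rewrite circle_pi0.
have e2 : 0 < e%:num / 2 by [].
have [n _ /(_ n (leqnn n)) ne] := near_infty_natSinv_lt (PosNum e2).
exists n; apply: subset_trans (closure_circle_arc (harmonic_gt0 n)) _.
move=> _ [r r0 <-]; apply: VU; apply: eV; apply: le_ball r0.
rewrite [leRHS]splitr; apply: lerD; exact: ltW.
Qed.

(** * Descriptive complexity of the convergence set *)

Lemma Fsigmadelta_borel (T : topologicalType) (A : set T) :
  Fsigmadelta A -> borel A.
Proof.
move=> [F FP ->]; have sC : forall B : set T, borel B -> borel (~` B).
  move=> B bB M MP; have [[_ sc _] _] := MP.
  by rewrite -setTD; apply: sc; exact: bB.
have bF i : borel (F i).
  have [G cG ->] := FP i; apply: sigma_algebra_bigcup => n.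
  rewrite -[G n]setCK; apply: (sC); apply: sub_sigma_algebra.
  by rewrite /= openC.
rewrite -[\bigcap_i F i]setCK setC_bigcap; apply: (sC).
by apply: sigma_algebra_bigcup => i; apply: (sC); exact: bF.
Qed.

(** Each [G] gives a closed condition: no condition if the extended node is big, otherwise that some
    [n] in the finite [G] violates an open condition. *)
Lemma closed_captures (I : set (set nat)) (T : Type)
    (S : seq T -> set (set nat)) (v : seq T * seq nat) (m : nat)
    (K : topologicalType) (O : nat -> set K) :
  (forall n, open (O n)) -> closed [set x | captures I S v m [set n | O n x]].
Proof.
move=> oO; rewrite (_ : [set x | _] = \bigcap_G
  [set x | [set` G] `<=` [set n | (m <= n)%N /\ O n x] ->
           big_node I S (v.1, v.2 ++ G)]); last first.
  by apply/seteqP; split=> [x cx G _|x cx G]; [exact: cx|exact: (cx G Logic.I)].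
apply: closed_bigI => G _.
have [bG|nG] := pselect (big_node I S (v.1, v.2 ++ G)).
  rewrite (_ : [set x | _] = setT); first exact: closedT.
  by apply/seteqP; split=> [x _|x _ _].
rewrite (_ : [set x | _] =
    \bigcup_(n in [set` G]) ~` [set x | (m <= n)%N /\ O n x]).
  apply: closed_bigcup => [|n _]; first exact: finite_seq.
  apply: open_closedC; have [mn|nm] := boolP (m <= n)%N.
    by rewrite (_ : [set x | _] = O n) //; apply/seteqP; split=> x // [].
  by rewrite (_ : [set x | _] = set0); [exact: open0|];
    apply/seteqP; split=> x // [].
apply/seteqP; split=> [x cx|x [n nG' nO] xG]; last by case: nO; exact: xG.
by rewrite -setC_bigcap => xG; apply: nG; apply: cx => n /xG.
Qed.

Theorem theorem6p5 (R : realType) (I : set (set nat))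
    (hP : P_ideal I) (hA : analytic_ideal R I)
    (K : topologicalZmodType)
    (hK : compact [set: K]) (hT2 : hausdorff_space K)
    (u : nat -> K -> circle R) (hu : forall n, dual_group R K (u n)) :
  Fsigmadelta (ideal_characterized I u) /\ borel (ideal_characterized I u).
Proof.
suff : Fsigmadelta (ideal_characterized I u).
  by move=> FK; split => //; exact: Fsigmadelta_borel.
have [[I0 Isub IU] _] := hP; have [S hS] := analytic_scheme I0 hA.
pose O j n := [set x | ~ closure (circle_arc (harmonic j : R)) (u n x)].
have oO j n : open (O j n).
  have [_ cu] := hu n; apply: (@open_comp _ _ (u n) (~` closure _)).
    by move=> x _; exact: cu.
  by apply: closed_openC; exact: closed_closure.
(* [I] need not contain the singletons: the first factor keeps the whole set,
   and not only a tail of it, inside the union of [I]. *)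
pose F (jv : nat * (seq (nat * nat) * seq nat)) : set K :=
  \bigcup_m ((\bigcap_(n in ~` \bigcup_(A in I) A) ~` O jv.1 n) `&`
    [set x | big_node I S jv.2 -> captures I S jv.2 m [set n | O jv.1 n x]]).
exists (fun i => oapp F setT (unpickle i)) => [i|].
  case: unpickle => [[j v]|] /=; last exact/closed_Fsigma/closedT.
  exists (fun m => (\bigcap_(n in ~` \bigcup_(A in I) A) ~` O j n) `&`
    [set x | big_node I S v -> captures I S v m [set n | O j n x]]) => // m.
  apply: closedI; first by apply: closed_bigI => n _; exact: open_closedC.
  (* Bigness of [v] does not depend on [x], so it can be decided before taking the set of [x]. *)
  have [bv|nbv] := pselect (big_node I S v).
    rewrite (_ : [set x | _] = [set x | captures I S v m [set n | O j n x]]).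
      exact: closed_captures.
    by apply/seteqP; split=> [x /(_ bv)|x cx _].
  rewrite (_ : [set x | _] = setT); first exact: closedT.
  by apply/seteqP; split=> x // _ /nbv.
apply/seteqP; split=> [x xI i _|x xF U /circle_nbhs0[j jU]].
  case: unpickle => [[j v]|] //=.
  have IO : I [set n | O j n x].
    apply: xI; apply: filterS (circle_arc_nbhs (harmonic_gt0 j)).
    exact: subset_closure.
  have [bv|nbv] := pselect (big_node I S v); last first.
    by exists 0%N => //; split=> // n nI Ox; apply: nI; exists [set n | O j n x].
  have [m cm] := captures_ideal hP bv IO; exists m => //; split=> // n nI Ox.
  by apply: nI; exists [set n | O j n x].
suff : I [set n | O j n x] by apply: Isub => n nU /jU.
have xF' v : F (j, v) x by have := xF (pickle (j, v)) Logic.I; rewrite pickleK.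
apply: (ideal_captures hP hS) => [n On|v bv].
  (* The first factor is the same for all nodes; the root serves to extract it. *)
  have [m _ [xI _]] := xF' ([::], [::]).
  by apply: contrapT => nI; apply: (xI n) => // -[A IA An]; apply: nI; exists A.
by have [m _ [_ /(_ bv) cm]] := xF' v; exists m.
Qed.
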